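(* Let $d=d(n)$ with $2\le d\le n-1$ and let $k=k(n)$. Then, as $n\to\infty$, $$R(\mathcal A_k,\mathcal X_d)\;\ge\;\frac12\left(1-o(1)\right)\qquad\text{whenever } k=o(nd).$$
   Context: For a symmetric positive definite $n\times n$ matrix $\Sigma$ (a covariance matrix) with $K=\Sigma^{-1}$, the concentration graph is the graph on the $n$ indices with an edge $ij$ ($i\ne j$) iff $K_{ij}\ne0$. $\mathcal X_d$ is the class of $n\times n$ covariance matrices whose concentration graph is a tree of maximum degree bounded by $d$; for $\Sigma\in\mathcal X_d$, $T(\Sigma)$ denotes this tree. A covariance oracle returns, on input a pair of indices $(i,j)$, the entry $\Sigma_{ij}$. $\mathcal A_k$ is the class of all randomized adaptive algorithms that query the covariance oracle at most $k$ times (adaptive means that each query may depend on the answers to the previous queries and on the internal randomization). An algorithm $A\in\mathcal A_k$ outputs a tree $\mathcal T(A)$. For $\Sigma\in\mathcal X_d$ let $P(A,\Sigma)=\mathbb P\{\mathcal T(A)\ne T(\Sigma)\}$, where the probability is with respect to the randomization of $A$ run on $\Sigma$. The minimax risk is $R(\mathcal A_k,\mathcal X_d)=\inf_{A\in\mathcal A_k}\sup_{\Sigma\in\mathcal X_d}P(A,\Sigma)$. *)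

(* Defs.v *)
From mathcomp Require Import all_boot all_order all_algebra.
From mathcomp Require Import all_classical all_reals all_analysis.
Import Order.TTheory GRing.Theory Num.Theory.
Import numFieldNormedType.Exports.

Set Implicit Arguments.
Unset Strict Implicit.
Unset Printing Implicit Defensive.

Local Open Scope classical_set_scope.
Local Open Scope ring_scope.

(* An undirected edge ij is recorded by both ordered pairs (i, j), (j, i). *)
Definition graph (n : nat) := {set 'I_n * 'I_n}.

Definition adj (n : nat) (G : graph n) : rel 'I_n := fun i j => (i, j) \in G.

Definition max_degree_le (n d : nat) (G : graph n) : Prop :=
  forall i : 'I_n, (#|[pred j | adj G i j]| <= d)%N.

(* Duplicate-free cyclic sequences of length 1 or 2 are not graph cycles:
   [:: i; j] just runs back and forth along the edge ij. *)
Definition is_tree (n : nat) (G : graph n) : Prop :=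
  [/\ irreflexive (adj G),
      symmetric (adj G),
      forall i j : 'I_n, connect (adj G) i j
    & forall c : seq 'I_n, (2 < size c)%N -> ~ ucycle (adj G) c].

Definition tree (n : nat) := {G : graph n | is_tree G}.

Section Covariance.
Context {R : realType}.

Definition covariance (n : nat) (S : 'M[R]_n) : Prop :=
  S^T = S /\ forall x : 'cV[R]_n, x != 0 -> 0 < (x^T *m S *m x) 0 0.

Definition concentration_graph (n : nat) (S : 'M[R]_n) : graph n :=
  [set p | (p.1 != p.2) && (invmx S p.1 p.2 != 0)]%SET.

Definition tree_covariance (n d : nat) : set 'M[R]_n :=
  [set S | [/\ covariance S,
               is_tree (concentration_graph S)
             & max_degree_le d (concentration_graph S)]].

End Covariance.

(* A deterministic adaptive algorithm: either stop and output a tree, or query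
   a pair of indices and continue according to the real number returned. *)
Inductive strategy (R : Type) (n : nat) : Type :=
| Output of tree n
| Query of 'I_n & 'I_n & (R -> strategy R n).

Section Algorithms.
Context {R : realType}.

Fixpoint output (n : nat) (S : 'M[R]_n) (s : strategy R n) : tree n :=
  match s with
  | Output t => t
  | Query i j f => output S (f (S i j))
  end.

Fixpoint num_queries (n : nat) (S : 'M[R]_n) (s : strategy R n) : nat :=
  match s with
  | Output _ => 0
  | Query i j f => (num_queries S (f (S i j))).+1
  end.

End Algorithms.

(* All the internal randomization is drawn at once, as a point of an arbitrary
   probability space; it then determines the strategy that is followed.  The
   only regularity required is that the output be a random variable. *)
Record rand_algorithm (R : realType) (n : nat) := RandAlgorithm {
  ra_display : measure_display;
  ra_space : measurableType ra_display;
  ra_prob : probability ra_space R;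
  ra_strategy : ra_space -> strategy R n;
  ra_measurable : forall (S : 'M[R]_n) (t : tree n), covariance S ->
    measurable [set w | output S (ra_strategy w) = t]
}.

Section Risk.
Context {R : realType}.
Local Open Scope ereal_scope.

Definition query_bounded (n k : nat) (A : rand_algorithm R n) : Prop :=
  forall (S : 'M[R]_n) (w : ra_space A), covariance S ->
    (num_queries S (ra_strategy w) <= k)%N.

Definition error_probability (n : nat) (A : rand_algorithm R n)
    (S : 'M[R]_n) : \bar R :=
  ra_prob A [set w | sval (output S (ra_strategy w)) <> concentration_graph S].

(* The class AA is a bare predicate because the universe of [set] is too small
   for [rand_algorithm], which quantifies over all measurable types. *)
Definition minimax_risk (n : nat) (AA : rand_algorithm R n -> Prop)
    (X : set 'M[R]_n) : \bar R :=
  ereal_inf [set r | exists2 A : rand_algorithm R n, AA A &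
    r = ereal_sup [set error_probability A S | S in X]].

End Risk.

(* Main.v *)
Require Import Defs.
From mathcomp Require Import all_boot all_order all_algebra.
From mathcomp Require Import perm zify ring lra.
From mathcomp Require Import all_classical all_reals all_analysis measurable_realfun.
Import Order.TTheory GRing.Theory Num.Theory.
Import numFieldNormedType.Exports.

(* Take a base covariance S0 and N alternatives S_t in the class with trees
   different from that of S0, such that every entry (u, v) tells at most c of the
   S_t apart from S0.  On S0 a run of k queries leaves at least N - c k of the
   alternatives indistinguishable from S0, so that the errors on S0 and on a
   uniformly random S_t add up to at least 1 - c k / N.  It remains to find
   such families with c = 2 and N of order n d.

   All the covariances are S_uv = 2^-dist(u, v) for a rooted tree metric: they
   follow the structural equations X_u = w_u X_(parent u) + noise.  For d <= 3
   the tree is a path and S_t exchanges the vertices 2t and 2t+1, which only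
   affects two rows and columns.  For d >= 4 it is a caterpillar whose hubs carry
   about d/2 leaves at distance 1 and d/2 leaves at distance 2; detaching a
   long leaf b from its hub and hanging it at distance 1 below a short leaf a of
   the same hub changes the single distance dist(a, b), and there are about
   (n/d) (d/2)^2 such pairs. *)

Set Implicit Arguments.
Unset Strict Implicit.
Unset Printing Implicit Defensive.

Local Open Scope classical_set_scope.
Local Open Scope ring_scope.

(** * Rooted tree metrics and their parent graphs *)

(** The vertex of rank 0 is the root. When [rank b <= rank a] and [a != b], [b] is not below [a], so
    the path from [a] to [b] starts with the edge to the parent of [a]; [dist_parent] encodes
    this. *)
Record rooted_metric (n : nat) := RootedMetric {
  parent : 'I_n -> 'I_n;
  rank : 'I_n -> nat;
  dist : 'I_n -> 'I_n -> nat;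
  rank_parent : forall a, (0 < rank a)%N -> (rank (parent a) < rank a)%N;
  root_unique : forall a b, rank a = 0%N -> rank b = 0%N -> a = b;
  distC : forall a b, dist a b = dist b a;
  dist_refl : forall a, dist a a = 0%N;
  dist_parent_gt0 : forall a, (0 < rank a)%N -> (0 < dist a (parent a))%N;
  dist_parent : forall a b, a != b -> (rank b <= rank a)%N ->
    dist a b = (dist a (parent a) + dist (parent a) b)%N
}.
Arguments parent {n} r _.
Arguments rank {n} r _.
Arguments dist {n} r _ _.

Definition parent_graph {n : nat} (M : rooted_metric n) : graph n :=
  [set p | ((0 < rank M p.1)%N && (parent M p.1 == p.2)) ||
           ((0 < rank M p.2)%N && (parent M p.2 == p.1))]%SET.

Lemma adj_parent_graph (n : nat) (M : rooted_metric n) (a b : 'I_n) :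
  adj (parent_graph M) a b =
  ((0 < rank M a)%N && (parent M a == b)) || ((0 < rank M b)%N && (parent M b == a)).
Proof. by rewrite /adj inE. Qed.

Lemma parent_graph_tree (n : nat) (M : rooted_metric n) : is_tree (parent_graph M).
Proof.
have symG : symmetric (adj (parent_graph M)).
  by move=> a b; rewrite !adj_parent_graph orbC.
split=> //.
- move=> a; rewrite adj_parent_graph orbb; apply/negP=> /andP[/rank_parent + /eqP ea].
  by rewrite ea ltnn.
- have to_root (a : 'I_n) : exists2 r, rank M r = 0%N & connect (adj (parent_graph M)) a r.
    have [m] := ubnP (rank M a); elim: m a => // m IHm a ltam.
    have [a0|a_gt0] := posnP (rank M a); first by exists a.
    have [r r0 cr] := IHm (parent M a) (leq_trans (rank_parent a_gt0) ltam).
    exists r => //; apply: connect_trans cr; apply: connect1.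
    by rewrite adj_parent_graph a_gt0 eqxx.
  move=> a b; have [r r0 car] := to_root a; have [r' r'0 cbr] := to_root b.
  rewrite (root_unique r'0 r0) in cbr.
  by apply: connect_trans car _; rewrite (sym_connect_sym symG).
- move=> c c_gt2 /andP[cyc_c uniq_c].
  (* A vertex of maximal rank has both its cyclic neighbours equal to its parent. *)
  have [x0 x0c] : exists x0, x0 \in c.
    by case: c c_gt2 {cyc_c uniq_c} => // x c _; exists x; rewrite mem_head.
  have [x xc xmax] := @arg_maxnP _ x0 (mem c) (rank M) x0c.
  have up y : y \in c -> adj (parent_graph M) x y -> y = parent M x.
    move=> yc; rewrite adj_parent_graph => /orP[/andP[_ /eqP//]|/andP[y_gt0 /eqP yx]].
    by have := rank_parent y_gt0; rewrite yx ltnNge (xmax y yc : rank M y <= rank M x)%N.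
  have [i c' defc] := rot_to xc.
  have := c_gt2; rewrite -(size_rot i) defc => c'_gt1.
  have := cyc_c; have := uniq_c; rewrite -(rot_uniq i) -(rot_cycle i) defc.
  (* The rotated cycle reads [x], [y], ..., [z]; a length above 2 puts [y] and [z] at distinct
     positions, so [y = z] contradicts uniqueness. *)
  case/lastP: c' defc c'_gt1 => [|[|y c'] z] // defc _ /andP[_ /andP[yc' _]].
  have inc u : u \in rcons (y :: c') z -> u \in c.
    by move=> u_c'; rewrite -(mem_rot i) defc inE u_c' orbT.
  rewrite /= rcons_path last_rcons => /andP[xy /andP[_ zx]].
  have yp : y = parent M x by apply: up xy; apply: inc; rewrite mem_rcons inE mem_head orbT.
  have zp : z = parent M x by apply: up; [apply: inc; rewrite mem_rcons mem_head|rewrite symG].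
  by rewrite yp zp mem_rcons mem_head in yc'.
Qed.

(** The injective code lets candidates be listed in another type, for instance as naturals that need
    not be valid indices. *)
Lemma card_le_codom (T : finType) (U : eqType) (A : pred T) (f : T -> U) (s : seq U) :
  injective f -> (forall x, x \in A -> f x \in s) -> (#|A| <= size s)%N.
Proof.
move=> finj fs; rewrite cardE -(size_map f); apply: uniq_leq_size.
  by rewrite map_inj_uniq ?enum_uniq.
by move=> _ /mapP[x + ->]; rewrite mem_enum => /fs.
Qed.

Lemma max_degree_le_codom (n d : nat) (G : graph n) (U : eqType)
    (f : 'I_n -> U) (s : 'I_n -> seq U) :
  injective f -> (forall i, size (s i) <= d)%N ->
  (forall i j, adj G i j -> f j \in s i) -> max_degree_le d G.
Proof. by move=> finj sd fs i; apply: leq_trans (sd i); apply: card_le_codom (fs i). Qed.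

(** * Covariances of tree metrics *)

Section TreeCovariance.
Context {R : realType} {n : nat} (M : rooted_metric n).

Definition metric_cov : 'M[R]_n := \matrix_(i, j) (2^-1) ^+ dist M i j.

(** [wt] is the coefficient of the structural equation at [a], zero at the root; [W] is the
    coefficient matrix and [v] the noise variance that gives each [X_a] variance 1. *)
Let wt (a : 'I_n) : R := if (0 < rank M a)%N then (2^-1) ^+ dist M a (parent M a) else 0.
Let W : 'M[R]_n := \matrix_(i, j) (wt i *+ (parent M i == j)).
Let v (a : 'I_n) : R := 1 - wt a ^+ 2.

Let wt_ge0 a : 0 <= wt a.
Proof. by rewrite /wt; case: ifP => // _; rewrite exprn_ge0 ?invr_ge0. Qed.

Let v_gt0 a : 0 < v a.
Proof.
rewrite /v /wt; case: ifP => [a_gt0|_]; last by rewrite expr0n subr0.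
rewrite subr_gt0 -exprM exprn_ilt1 ?invr_ge0 //; last by rewrite invf_lt1 ?ltr1n.
by rewrite muln_eq0 negb_or -lt0n dist_parent_gt0.
Qed.

Let sumW (a : 'I_n) (f : 'I_n -> R) : \sum_j (1%:M - W) a j * f j = f a - wt a * f (parent M a).
Proof.
under eq_bigr do rewrite !mxE mulrBl.
rewrite big_split /= (bigD1 a) //= eqxx mul1r big1 => [|j /negPf ja]; last first.
  by rewrite eq_sym ja mul0r.
rewrite addr0 (bigD1 (parent M a)) //= eqxx mulr1n big1 ?addr0 // => j /negPf jp.
by rewrite eq_sym jp mulr0n mul0r oppr0.
Qed.

(** Powers turn the sum in [dist_parent] into a product. The vertex [a] is not the root, for then
    [c] would be the root too. *)
Let cov_parent (a c : 'I_n) : a != c -> (rank M c <= rank M a)%N ->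
  metric_cov a c = wt a * metric_cov (parent M a) c.
Proof.
move=> ac rac; have a_gt0 : (0 < rank M a)%N.
  rewrite lt0n; apply/eqP => a0; move: rac; rewrite a0 leqn0 => /eqP c0.
  by rewrite (root_unique a0 c0) eqxx in ac.
by rewrite /wt a_gt0 !mxE -exprD -dist_parent.
Qed.

(** The noise at [a] is uncorrelated with every other vertex of rank at most [rank a], hence with
    the noise at [b] when [rank b <= rank a]; symmetry gives the other order. *)
Let whitening : (1%:M - W) *m metric_cov *m (1%:M - W)^T = diag_mx (\row_a v a).
Proof.
have E (a b : 'I_n) : ((1%:M - W) *m metric_cov *m (1%:M - W)^T) a b =
    metric_cov a b - wt a * metric_cov (parent M a) b
    - wt b * (metric_cov a (parent M b) - wt a * metric_cov (parent M a) (parent M b)).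
  rewrite mxE; under eq_bigr do rewrite mxE [_^T _ _]mxE sumW mulrC.
  by rewrite sumW.
have off (a b : 'I_n) : a != b -> (rank M b <= rank M a)%N ->
    ((1%:M - W) *m metric_cov *m (1%:M - W)^T) a b = 0.
  move=> ab rba; rewrite E -cov_parent // subrr sub0r.
  have [b0|b_gt0] := posnP (rank M b); first by rewrite {1}/wt b0 mul0r oppr0.
  have lt_pb := leq_trans (rank_parent b_gt0) rba.
  rewrite -cov_parent ?subrr ?mulr0 ?oppr0 // ?(ltnW lt_pb) //.
  by apply: contraTneq lt_pb => <-; rewrite ltnn.
apply/matrixP=> a b; rewrite [RHS]mxE [X in X *+ _]mxE.
have [->|ab] := eqVneq a b.
  rewrite E mulr1n /v.
  rewrite /wt; case: ifP => b_gt0; last by rewrite !mul0r !subr0 !mxE dist_refl expr0n subr0.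
  rewrite !mxE !dist_refl (distC M (parent M b) b) expr0; ring.
rewrite mulr0n.
have [rba|/ltnW rab] := leqP (rank M b) (rank M a); first exact: off.
have symL : ((1%:M - W) *m metric_cov *m (1%:M - W)^T)^T =
   (1%:M - W) *m metric_cov *m (1%:M - W)^T.
  rewrite !trmx_mul trmxK mulmxA; congr (_ *m _ *m _).
  by apply/matrixP=> i j; rewrite !mxE distC.
by rewrite -symL mxE off // eq_sym.
Qed.

Let L : 'M[R]_n := 1%:M - W.
Let D : 'M[R]_n := diag_mx (\row_a v a).
Let D' : 'M[R]_n := diag_mx (\row_a (v a)^-1).

Let DD' : D *m D' = 1%:M.
Proof.
rewrite mulmx_diag; apply/matrixP => a b; rewrite !mxE.
by rewrite mulfV ?(gt_eqF (v_gt0 a)).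
Qed.

Let K : 'M[R]_n := L^T *m D' *m L.

Let covK : metric_cov *m K = 1%:M.
Proof.
have LX : L *m (metric_cov *m L^T *m D') = 1%:M.
  by rewrite !mulmxA whitening DD'.
by have := mulmx1C LX; rewrite /K !mulmxA.
Qed.

Lemma metric_cov_pd : Defs.covariance metric_cov.
Proof.
split; first by apply/matrixP=> i j; rewrite !mxE distC.
have D'_pd (y : 'cV[R]_n) : y != 0 -> 0 < (y^T *m D' *m y) 0 0.
  move=> y0; rewrite mul_mx_diag mxE.
  under eq_bigr do rewrite !mxE.
  have pos i : 0 <= y i 0 / v i * y i 0.
    by rewrite mulrAC mulr_ge0 ?invr_ge0 ?(ltW (v_gt0 i)) // -expr2 sqr_ge0.
  rewrite lt_def sumr_ge0 // andbT; apply: contra_neq y0 => /eqP.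
  rewrite psumr_eq0 // => /allP y0; apply/matrixP=> i j; rewrite (ord1 j) [RHS]mxE.
  have := y0 i (mem_index_enum _).
  by rewrite /= !mulf_eq0 invr_eq0 (gt_eqF (v_gt0 i)) orbF orbb => /eqP.
move=> x x0.
(* In the variable [y] the quadratic form of [metric_cov] becomes that of the positive diagonal
   matrix [D']. *)
pose y := L *m (metric_cov *m x).
have yx : x = L^T *m (D' *m y).
  by rewrite /y !mulmxA -/K (mulmx1C covK) mul1mx.
have y0 : y != 0 by apply: contra_neq x0 => y0; rewrite yx y0 !mulmx0.
suff -> : x^T *m metric_cov *m x = y^T *m D' *m y by exact: D'_pd.
rewrite -!mulmxA {1}yx !trmx_mul trmxK -!mulmxA /y; congr (_ *m _).
by rewrite [D'^T]tr_diag_mx.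
Qed.

(** Off the diagonal, [K = L^T D' L] gets nothing from common children, since a vertex has one
    parent; the two remaining parent terms have the same sign and cannot cancel. *)
Lemma concentration_graph_metric : concentration_graph metric_cov = parent_graph M.
Proof.
have invE : invmx metric_cov = K.
  have [covU _] := mulmx1_unit covK.
  by rewrite -[RHS](mulKmx covU) covK mulmx1.
have [irr _ _ _] := parent_graph_tree M.
apply/setP=> -[a b]; rewrite !inE /= invE.
have [<-|ab] := eqVneq a b.
  by have := irr a; rewrite adj_parent_graph => ->.
have KE : K a b = - (W a b / v a + W b a / v b).
  rewrite /K mul_mx_diag mxE.
  under eq_bigr do rewrite !mxE.
  have -> : \sum_j ((j == a)%:R - wt j *+ (parent M j == a)) / v j *
                 ((j == b)%:R - wt j *+ (parent M j == b)) =
     \sum_j (- ((j == a)%:R * ((wt j *+ (parent M j == b)) / v j))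
             - (j == b)%:R * ((wt j *+ (parent M j == a)) / v j)).
    apply: eq_bigr => j _.
    have H1 : (j == a)%:R * (j == b)%:R = 0 :> R.
      by have [->|] := eqVneq j a; rewrite ?(negPf ab) ?mulr0 ?mul0r.
    have H2 : (wt j *+ (parent M j == a)) * (wt j *+ (parent M j == b)) = 0 :> R.
      by have [->|] := eqVneq (parent M j) a; rewrite ?(negPf ab) ?mulr0n ?mulr0 ?mul0r.
    move: (wt j *+ _) (wt j *+ _) H1 H2 => p q H1 H2.
    rewrite mulrAC mulrBl !mulrBr H1 H2; ring.
  rewrite big_split /= !sumrN opprD; congr (- _ - _).
    by rewrite (bigD1 a) //= eqxx mul1r big1 ?addr0 ?mxE // => j /negPf ->; rewrite mul0r.
  by rewrite (bigD1 b) //= eqxx mul1r big1 ?addr0 ?mxE // => j /negPf ->; rewrite mul0r.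
have Wge0 i j : 0 <= W i j / v i.
  by rewrite mulr_ge0 ?invr_ge0 ?(ltW (v_gt0 i)) // mxE mulrn_wge0.
have WN0 i j : (W i j / v i == 0) = ~~ ((0 < rank M i)%N && (parent M i == j)).
  rewrite mulf_eq0 invr_eq0 (gt_eqF (v_gt0 i)) orbF mxE /wt.
  case: (parent M i == j); rewrite ?mulr0n ?mulr1n ?eqxx ?andbF ?andbT //.
  by case: ifP => _; rewrite ?eqxx // expf_eq0 invr_eq0 pnatr_eq0 andbF.
by rewrite KE oppr_eq0 paddr_eq0 // !WN0 negb_and !negbK.
Qed.

Lemma metric_cov_tree (d : nat) : max_degree_le d (parent_graph M) ->
  tree_covariance d metric_cov.
Proof.
move=> deg; split; rewrite ?concentration_graph_metric //.
  exact: metric_cov_pd.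
exact: parent_graph_tree.
Qed.

End TreeCovariance.

(** * Lower bound from indistinguishable alternatives *)

(** [B] collects the alternatives exposed by the entries queried on [S0]; for the others all
    answers, hence all adaptive choices, coincide. *)
Lemma output_agree (R : realType) (n : nat) (I : finType) (S0 : 'M[R]_n)
    (S : I -> 'M[R]_n) (c k : nat) (s : strategy R n) :
  (forall u v, #|[pred t | S t u v != S0 u v]| <= c)%N ->
  (num_queries S0 s <= k)%N ->
  exists2 B : {set I}, (#|B| <= c * k)%N &
    forall t, t \notin B -> output (S t) s = output S0 s.
Proof.
move=> sep; elim: s k => [T|u v f IH] k /=.
  by move=> _; exists (finset.set0 : {set I}) => //; rewrite cards0.
case: k => // k /IH[B Bk agree].
exists (B :|: [set t | S t u v != S0 u v])%SET.
  rewrite mulnS addnC (leq_trans (leq_card_setU _ _)) // leq_add //.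
  by rewrite cardsE sep.
by move=> t; rewrite !inE negb_or negbK => /andP[tB /eqP ->]; exact: agree.
Qed.

(** The sum of the probabilities is the expected number of events that occur. *)
Lemma sum_probability_ge (R : realType) (disp : measure_display)
    (T : measurableType disp) (P : probability T R) (J : finType)
    (A : J -> set T) (m : nat) :
  (forall j, measurable (A j)) ->
  (forall w, m <= #|[pred j | w \in A j]|)%N ->
  (m%:R%:E <= \sum_j P (A j))%E.
Proof.
move=> mA cover.
have -> : (\sum_j P (A j) = \int[P]_w (\sum_j (\1_(A j) w)%:E)%E)%E.
  rewrite ge0_integral_sum //=; last by move=> j; apply/measurable_EFinP; exact: measurable_indic.
  by apply: eq_bigr => j _; rewrite integral_indic // setIT.
have -> : m%:R%:E = (\int[P]_(w in setT) (m%:R : R)%:E)%E.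
  by rewrite integral_cst // -[X in (_ * X)%E]/(P setT) probability_setT mule1.
apply: ge0_le_integral => //.
  by apply: emeasurable_sum => j; apply/measurable_EFinP; exact: measurable_indic.
move=> w _; rewrite sumEFin lee_fin.
under eq_bigr do rewrite indicE.
rewrite -natr_sum ler_nat (leq_trans (cover w)) // -sum1_card big_mkcond.
by apply: leq_sum => j _; rewrite inE; case: (_ \in _).
Qed.

Lemma measurable_error (R : realType) (n : nat) (A : rand_algorithm R n) (S : 'M[R]_n) :
  Defs.covariance S -> is_tree (concentration_graph S) ->
  measurable [set w | sval (output S (ra_strategy (r:=A) w)) <> concentration_graph S].
Proof.
move=> covS treeS.
rewrite (_ : [set w | _] =
    ~` [set w | output S (ra_strategy (r:=A) w) = exist _ (concentration_graph S) treeS]).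
  by apply: measurableC; exact: ra_measurable.
apply/seteqP; split=> w /= ne e; apply: ne; first by rewrite e.
by case: (output _ _) e => G tG /= e; exact: eq_exist.
Qed.

(* Le Cam's two-point argument, the second hypothesis being the uniform mixture
   of the [S t]. *)
Lemma minimax_risk_ge (R : realType) (n d c k : nat) (I : finType)
    (S0 : 'M[R]_n) (S : I -> 'M[R]_n) :
  (0 < #|I|)%N -> tree_covariance d S0 -> (forall t, tree_covariance d (S t)) ->
  (forall t, concentration_graph (S t) <> concentration_graph S0) ->
  (forall u v, #|[pred t | S t u v != S0 u v]| <= c)%N ->
  ((1 / 2 * (1 - (c * k)%:R / #|I|%:R))%:E <=
    minimax_risk (@query_bounded R n k) (tree_covariance d))%E.
Proof.
move=> I_gt0 XS0 XS graph_neq sep.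
apply: le_ereal_inf_tmp => _ [A Ak ->].
(* Repeating [S0] once per alternative gives the two hypotheses equal weight. *)
pose H (j : bool * I) := if j.1 then S0 else S j.2.
pose err (j : bool * I) :=
  [set w | sval (output (H j) (ra_strategy (r:=A) w)) <> concentration_graph (H j)].
pose j0 : bool * I := (true, enum_val (Ordinal I_gt0)).
have XH j : tree_covariance d (H j) by rewrite /H; case: ifP.
have covH j : Defs.covariance (H j) by case: (XH j).
have merr j : measurable (err j).
  by case: (XH j) => cov tr _; exact: measurable_error.
have cover w : (#|I| - c * k <= #|[pred j | w \in err j]|)%N.
  have [B Bk agree] := output_agree sep (Ak S0 w (covH j0)).
  have dec (j : bool * I) : (w \in err j) =
      (sval (output (H j) (ra_strategy w)) != concentration_graph (H j)).
    by apply/idP/idP => [/set_mem/eqP//|/eqP e]; exact/mem_set.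
  (* For [t] outside [B] the common output is wrong on [S0] or, if right there, wrong on [S t]; [b]
     selects the case, so [(b, t)] is always an error. *)
  pose b := sval (output S0 (ra_strategy w)) != concentration_graph S0.
  apply: (@leq_trans #|~: B|%SET).
    by rewrite cardsCs finset.setCK leq_sub2l.
  rewrite -(card_imset (pred_of_set (~: B)%SET) (f := pair b)); last by move=> ? ? [].
  apply/subset_leq_card/fintype.subsetP => _ /imsetP[t + ->]; rewrite finset.inE => /agree tB.
  rewrite -[_ \in _]/(w \in err (b, t)) dec /H /=.
  have [e|e] := eqVneq (sval (output S0 (ra_strategy w))) (concentration_graph S0);
    last by rewrite /b e.
  by rewrite /b e eqxx /= tB e; apply/eqP/nesym.
have := sum_probability_ge (ra_prob A) merr cover.
set M := ereal_sup _; move=> sum_ge.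
have leM j : (ra_prob A (err j) <= M)%E.
  by apply: ereal_sup_ubound; exists (H j).
have P_fin j : ra_prob A (err j) \is a fin_num by apply: fin_num_measure.
(* The index [j0] excludes the value -oo: [M] bounds an actual probability. *)
have := leM j0; case: M leM {sum_ge} (sum_ge) => [r| |] leM sum_ge le_j0; last 2 first.
- by rewrite leey.
- by have := P_fin j0; move: le_j0; rewrite leeNy_eq => /eqP ->.
have : ((#|I| - c * k)%:R%:E <= (\sum_(j : bool * I) r%:E))%E.
  by apply: le_trans sum_ge _; apply: lee_sum => j _.
rewrite sumEFin lee_fin sumr_const card_prod card_bool -[r *+ _]mulr_natr natrM => le_r.
have Igt0 : 0 < #|I|%:R :> R by rewrite ltr0n.
have : #|I|%:R - (c * k)%:R <= (#|I| - c * k)%:R :> R.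
  have [le_ck|lt_ck] := leqP (c * k) #|I|; first by rewrite natrB.
  by rewrite (le_trans _ (ler0n _ _)) // subr_le0 ler_nat ltnW.
move=> /le_trans/(_ le_r) h.
rewrite lee_fin -(ler_pM2r Igt0).
have -> : 1 / 2 * (1 - (c * k)%:R / #|I|%:R) * #|I|%:R = 1 / 2 * (#|I|%:R - (c * k)%:R) :> R.
  by field; rewrite gt_eqF.
lra.
Qed.

(** * Paths *)

Section Path.
Context {n : nat} (s : {perm 'I_n}).
Local Open Scope nat_scope.

(** [s a] is the position of [a] on the path; the first vertex is its own parent, as 0 is its own
    predecessor. *)
Definition path_parent (a : 'I_n) : 'I_n := (s^-1)%g (insubd (s a) (s a).-1).

Definition path_dist (a b : 'I_n) : nat := (s a - s b) + (s b - s a).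

Lemma val_path_parent (a : 'I_n) : s (path_parent a) = (s a).-1 :> nat.
Proof. by rewrite permKV val_insubd (leq_ltn_trans (leq_pred _)). Qed.

Lemma perm_val_eq (a b : 'I_n) : (a == b) = (s a == s b :> nat).
Proof. by rewrite val_eqE (inj_eq (@perm_inj _ s)). Qed.

Lemma path_rank_parent (a : 'I_n) : 0 < s a -> s (path_parent a) < s a.
Proof. by move=> a_gt0; rewrite val_path_parent prednK. Qed.

Lemma path_root_unique (a b : 'I_n) : s a = 0 :> nat -> s b = 0 :> nat -> a = b.
Proof. by move=> a0 b0; apply/eqP; rewrite perm_val_eq a0 b0. Qed.

Lemma path_distC (a b : 'I_n) : path_dist a b = path_dist b a.
Proof. exact: addnC. Qed.

Lemma path_dist_refl (a : 'I_n) : path_dist a a = 0.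
Proof. by rewrite /path_dist subnn. Qed.

Lemma path_dist_parent_gt0 (a : 'I_n) : 0 < s a -> 0 < path_dist a (path_parent a).
Proof. by rewrite /path_dist val_path_parent; lia. Qed.

Lemma path_dist_parent (a b : 'I_n) : a != b -> s b <= s a ->
  path_dist a b = path_dist a (path_parent a) + path_dist (path_parent a) b.
Proof. by rewrite perm_val_eq /path_dist val_path_parent; lia. Qed.

Definition path_metric : rooted_metric n :=
  RootedMetric path_rank_parent path_root_unique path_distC path_dist_refl
    path_dist_parent_gt0 path_dist_parent.

Lemma adj_path (a b : 'I_n) :
  adj (parent_graph path_metric) a b =
  ((s a).+1 == s b :> nat) || ((s b).+1 == s a :> nat).
Proof.
have parentE (x y : 'I_n) :
    (0 < s x) && (path_parent x == y) = ((s y).+1 == s x :> nat).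
  by rewrite perm_val_eq val_path_parent; lia.
by rewrite adj_parent_graph /= !parentE orbC.
Qed.

Lemma path_degree : max_degree_le 2 (parent_graph path_metric).
Proof.
apply: (@max_degree_le_codom _ _ _ _ (fun a => val (s a)) (fun a => [:: (s a).+1; (s a).-1])) => //.
- by move=> a b /val_inj/perm_inj.
- by move=> a b; rewrite adj_path !inE => /orP[/eqP ->|/eqP <-]; rewrite eqxx ?orbT.
Qed.

End Path.

Lemma path_minimax_risk_ge (R : realType) (n d k : nat) : (3 <= n)%N -> (2 <= d)%N ->
  ((1 / 2 * (1 - (2 * k)%:R / (n.-1 %/ 2)%:R))%:E <=
    minimax_risk (@query_bounded R n k) (@tree_covariance R n d))%E.
Proof.
move=> n_ge3 d_ge2.
(* With [n.-1] the vertex [nx t] after the swapped pair exists; it is adjacent to [lo t] only after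
   the swap, which separates the trees. *)
set N := (n.-1 %/ 2)%N.
have nx_lt (t : 'I_N) : ((2 * t).+2 < n)%N by have := ltn_ord t; rewrite /N; lia.
pose lo t : 'I_n := Ordinal (ltnW (ltnW (nx_lt t))).
pose hi t : 'I_n := Ordinal (ltnW (nx_lt t)).
pose nx t : 'I_n := Ordinal (nx_lt t).
pose base := path_metric (1 : {perm 'I_n})%g.
pose swapped t := path_metric (tperm (lo t) (hi t)).
have deg s : max_degree_le d (parent_graph (@path_metric n s)).
  by move=> i; apply: leq_trans (path_degree s i) d_ge2.
have cardN : #|'I_N| = N by rewrite card_ord.
rewrite -[X in (2 * k)%:R / X%:R]cardN.
apply: (@minimax_risk_ge _ _ _ _ _ _ (metric_cov base) (fun t => metric_cov (swapped t))).
- by rewrite card_ord /N; lia.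
- exact/metric_cov_tree/deg.
- by move=> t; exact/metric_cov_tree/deg.
- move=> t; rewrite !concentration_graph_metric => /setP/(_ (lo t, nx t)).
  rewrite -![_ \in parent_graph _]/(adj _ (lo t) (nx t)) !adj_path !perm1 tpermL tpermD; last 2 first.
  + by rewrite -val_eqE /=; lia.
  + by rewrite -val_eqE /=; lia.
  by rewrite /= eqxx /=; lia.
- move=> u v.
  (* An entry can change only if [u] or [v] is one of [2t], [2t+1]. *)
  apply: (@card_le_codom _ _ _ val [:: u %/ 2; v %/ 2]%N) => [|t]; first exact: val_inj.
  rewrite !inE /=; apply: contra_neqT; rewrite negb_or => /andP[tu tv].
  by rewrite !mxE /= /path_dist !perm1 !tpermD // -val_eqE /=; lia.
Qed.

(** * Caterpillars *)

Section Caterpillar.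
Local Open Scope nat_scope.
Context {n : nat} (D : nat) (D_gt0 : (0 < D)%N).

(* Blocks of D consecutive nodes: a hub, then (D-1)/2 short leaves, then long
   leaves; [leg u] is the distance from u to its hub.  The last block may be
   truncated, but always contains its hub. *)
Definition leg (u : nat) : nat :=
  if u %% D == 0 then 0 else if (u %% D <= D.-1./2)%N then 1 else 2.

(** A hub is sent to the preceding hub and, by truncated subtraction, the first hub to itself. *)
Definition hub_of (u : 'I_n) : 'I_n :=
  Ordinal (leq_ltn_trans (leq_subr (if u %% D == 0 then D else u %% D)%N u) (ltn_ord u)).

Lemma leg_hub_of (u : 'I_n) : leg (hub_of u) = 0%N.
Proof.
rewrite /leg /=; suff -> : (u - (if u %% D == 0 then D else u %% D)) %% D = 0 by rewrite eqxx.
case: ifP => [/eqP u0|_]; last by rewrite {1}(divn_eq u D) addnK modnMl.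
have [/ltnW/eqP ->|leDu] := ltnP u D; first by rewrite mod0n.
by rewrite -(modnDr _ D) subnK ?u0.
Qed.

Lemma div_hub_of (u : 'I_n) : (hub_of u %/ D = u %/ D - (leg u == 0))%N.
Proof.
rewrite /leg /=; case: ifP => [_|u0]; first by rewrite -{1}[D]mul1n divnBMl.
rewrite {1}(divn_eq u D) addnK mulnK //; case: ifP => _; rewrite subn0 //.
Qed.

Lemma leg0_div_inj (u v : 'I_n) : leg u = 0%N -> leg v = 0%N -> u %/ D = v %/ D -> u = v.
Proof.
have E w : leg w = 0%N -> w = (w %/ D * D)%N.
  have := divn_eq w D; rewrite /leg; case: eqP => [-> {1}-> _|_ _]; first by rewrite addn0.
  by case: ifP.
by move=> /E u0 /E v0 uv; apply: val_inj; rewrite /= u0 v0 uv.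
Qed.

(* [Some (a, b)]: the long leaf b hangs below the short leaf a. *)
Context (moved : option ('I_n * 'I_n)).

Definition movable : Prop := forall a b, moved = Some (a, b) ->
  [/\ a %/ D = b %/ D, leg a = 1%N & leg b = 2%N].

Definition cater_parent (u : 'I_n) : 'I_n :=
  if moved is Some (a, b) then if u == b then a else hub_of u else hub_of u.

(** Lexicographic order on leg and block, blocks being numbered below [n]. Short leaves precede long
    ones, so a moved leaf still ranks above its new parent. *)
Definition cater_rank (u : 'I_n) : nat := (leg u * n + u %/ D)%N.

(** A moved [b] keeps distance 2 to its hub, as 1 + 1 through [a]; hence only the pair itself
    changes, from 3 to 1. *)
Definition cater_dist (u v : 'I_n) : nat :=
  if u == v then 0%N else
  if (moved == Some (u, v)) || (moved == Some (v, u)) then 1%N else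
  ((u %/ D - v %/ D) + (v %/ D - u %/ D) + leg u + leg v)%N.

Lemma leg_le2 u : (leg u <= 2)%N.
Proof. by rewrite /leg; case: ifP => // _; case: ifP. Qed.

Lemma cater_rank_leg (u v : 'I_n) : (cater_rank u <= cater_rank v)%N ->
  (leg u < leg v)%N \/ (leg u = leg v /\ u %/ D <= v %/ D)%N.
Proof.
have := leq_ltn_trans (leq_div u D) (ltn_ord u).
have := leq_ltn_trans (leq_div v D) (ltn_ord v).
rewrite /cater_rank; move: (u %/ D) (v %/ D) (leg_le2 u) (leg_le2 v) => hu hv.
case: (leg u) => [|[|[|?]]] //; case: (leg v) => [|[|[|?]]] //; lia.
Qed.

Lemma cater_rank_lt (u v : 'I_n) :
  (leg u < leg v)%N \/ (leg u = leg v /\ u %/ D < v %/ D)%N ->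
  (cater_rank u < cater_rank v)%N.
Proof.
have := leq_ltn_trans (leq_div u D) (ltn_ord u).
have := leq_ltn_trans (leq_div v D) (ltn_ord v).
rewrite /cater_rank; move: (u %/ D) (v %/ D) (leg_le2 u) (leg_le2 v) => hu hv.
case: (leg u) => [|[|[|?]]] //; case: (leg v) => [|[|[|?]]] //; lia.
Qed.

Context (mv : movable).

Lemma cater_parentP (u : 'I_n) :
  (moved = Some (cater_parent u, u)) \/
  (cater_parent u = hub_of u /\ forall a, moved <> Some (a, u)).
Proof.
rewrite /cater_parent; case: moved => [[a b]|]; last by right.
case: eqP => [->|ub]; first by left.
by right; split=> // a' [_ /esym].
Qed.

Lemma cater_rank_parent (u : 'I_n) : (0 < cater_rank u)%N ->
  (cater_rank (cater_parent u) < cater_rank u)%N.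
Proof.
move=> u_gt0; apply: cater_rank_lt.
case: (cater_parentP u) => [/mv[_ -> ->]|[-> _]]; first by left.
rewrite leg_hub_of div_hub_of; case: posnP => [u0|]; last by left.
right; split=> //; move: u_gt0; rewrite /cater_rank u0.
by rewrite subn1; case: (_ %/ _)%N.
Qed.

Lemma cater_root_unique (u v : 'I_n) : cater_rank u = 0%N -> cater_rank v = 0%N -> u = v.
Proof.
rewrite /cater_rank => /eqP + /eqP; rewrite !addn_eq0 !muln_eq0.
have n0 : (n == 0)%N = false by case: (n) u => // -[].
rewrite n0 !orbF => /andP[/eqP u0 /eqP hu] /andP[/eqP v0 /eqP hv].
by apply: leg0_div_inj; rewrite // hu hv.
Qed.

Lemma cater_distC (u v : 'I_n) : cater_dist u v = cater_dist v u.
Proof. by rewrite /cater_dist eq_sym orbC; case: ifP => // _; case: ifP => // _; lia. Qed.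

Lemma cater_dist_refl (u : 'I_n) : cater_dist u u = 0%N.
Proof. by rewrite /cater_dist eqxx. Qed.

Lemma cater_dist_parent_gt0 (u : 'I_n) : (0 < cater_rank u)%N -> (0 < cater_dist u (cater_parent u))%N.
Proof.
move=> u_gt0; have := cater_rank_parent u_gt0; rewrite /cater_dist.
case: eqP => [<-|_ _]; first by rewrite ltnn.
case: ifP => // _; case: (cater_parentP u) => [/mv[_ -> ->]|[-> _]]; first by rewrite addnS.
rewrite leg_hub_of div_hub_of; move: u_gt0; rewrite /cater_rank.
by case: (leg u) => [|m]; rewrite ?mul0n ?add0n /=; lia.
Qed.

Lemma cater_dist_hub (u v : 'I_n) : u != v -> leg u = 0%N ->
  cater_dist u v = ((u %/ D - v %/ D) + (v %/ D - u %/ D) + leg v)%N.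
Proof.
move=> /negPf uv u0; rewrite /cater_dist uv u0 addn0.
by case: eqP => [/mv[_ e _]|_]; [rewrite u0 in e|case: eqP => [/mv[_ _ e]|//]; rewrite u0 in e].
Qed.

Lemma cater_dist_parent (u v : 'I_n) : u != v -> (cater_rank v <= cater_rank u)%N ->
  cater_dist u v = (cater_dist u (cater_parent u) + cater_dist (cater_parent u) v)%N.
Proof.
move=> uv ruv; have u_gt0 : (0 < cater_rank u)%N.
  rewrite lt0n; apply/eqP => u0; move: ruv; rewrite u0 leqn0 => /eqP v0.
  by rewrite (cater_root_unique u0 v0) eqxx in uv.
have pu : u != cater_parent u.
  by apply: contraTneq (cater_rank_parent u_gt0) => <-; rewrite ltnn.
have := cater_rank_leg ruv.
case: (cater_parentP u) => [mvu|[pE nmv]]; last first.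
- rewrite pE in pu *; rewrite [in X in (X + _)%N]cater_distC.
  rewrite [in X in (X + _)%N]cater_dist_hub ?leg_hub_of 1?eq_sym //.
  rewrite {1}/cater_dist (negPf uv) div_hub_of => lg.
  (* Such a pair would have [leg u = 1] and [leg v = 2], against the rank order. *)
  have -> : (moved == Some (u, v)) = false.
    by apply/eqP => /mv[_ lu lv]; move: lg; rewrite lu lv; lia.
  have -> : (moved == Some (v, u)) = false by apply/eqP/nmv.
  have hub_neq : leg u = 0%N -> leg v = 0%N -> u %/ D <> v %/ D :> nat.
    by move=> u0 v0 /leg0_div_inj e; rewrite e ?eqxx in uv.
  rewrite /=; have [<-|hv] := eqVneq (hub_of u) v.
    rewrite cater_dist_refl leg_hub_of div_hub_of; lia.
  rewrite cater_dist_hub ?leg_hub_of // div_hub_of.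
  have [u0|u_gt0'] := posnP (leg u); last by rewrite subn0; lia.
  have v0 : leg v = 0 by lia.
  move: lg (hub_neq u0 v0); rewrite u0 v0 /=.
  by move: (u %/ D) (v %/ D) => hu hv'; lia.
(* Here [u] is the moved leaf: its leg 2 splits into the edge of length 1 to [a] and the leg 1 of
   [a]. *)
- case: (mv mvu); move: mvu pu; set a := cater_parent u => mvu ua hau la lu _.
  rewrite {2}/cater_dist (negPf ua) mvu eqxx orbT.
  have [<-|av] := eqVneq a v.
    by rewrite cater_dist_refl addn0 /cater_dist (negPf ua) mvu eqxx orbT.
  have neq x y : x <> a \/ y <> u -> (moved == Some (x, y)) = false.
    by move=> xy; rewrite mvu; apply/eqP => -[ax uy]; case: xy; auto.
  have [ua' va vu] : [/\ u <> a, v <> a & v <> u].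
    by split; apply/eqP; rewrite // eq_sym.
  rewrite /cater_dist (negPf uv) (negPf av) !neq /=; try by [left|right].
  rewrite hau la lu; lia.
Qed.

Definition cater_metric : rooted_metric n :=
  RootedMetric cater_rank_parent cater_root_unique cater_distC cater_dist_refl
    cater_dist_parent_gt0 cater_dist_parent.

(** A hub meets at most the previous hub, [D - 1] leaves and the next hub; any other vertex meets
    its parent and possibly the moved leaf. *)
Lemma cater_degree : max_degree_le D.+1 (parent_graph cater_metric).
Proof.
apply: (@max_degree_le_codom _ _ _ _ val (fun u =>
  if leg u == 0 then (u - D)%N :: iota u.+1 D
  else val (cater_parent u) :: (if moved is Some (a, b) then [:: val b] else [::]))) => [|u|u v].
- exact: val_inj.
- by case: ifP => _; rewrite /= ?size_iota //; case: moved => [[]|].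
rewrite adj_parent_graph => /orP[] /andP[r_gt0 /eqP] /=.
  move=> <-; case: ifP => [/eqP u0|_]; last by rewrite mem_head.
  case: (cater_parentP u) => [/mv[_ _]|[-> _]]; first by rewrite u0.
  by move: u0; rewrite /leg /=; case: ifP => [_ _|_]; [rewrite mem_head|case: ifP].
case: (cater_parentP v) => [mvv|[-> _]] pv.
  by rewrite pv in mvv; case: (mv mvv) => _ -> _; rewrite mvv !inE eqxx orbT.
rewrite -pv leg_hub_of eqxx inE mem_iota /=.
have vD : (v %% D < D)%N by rewrite ltn_mod.
have := leq_mod v D; case: ifP => [/eqP v0 _|v0 le_v]; last by lia.
have [ltvD|] := ltnP v D; last by lia.
have v00 : v = 0%N :> nat by rewrite -v0 modn_small.
by move: r_gt0; rewrite /= /cater_rank /leg v00 mod0n div0n.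
Qed.

End Caterpillar.

Lemma caterpillar_minimax_risk_ge (R : realType) (n D k : nat) : (3 <= D <= n)%N ->
  ((1 / 2 * (1 - (2 * k)%:R / ((n %/ D) * (D.-1./2 * D.-1./2))%:R))%:E <=
    minimax_risk (@query_bounded R n k) (@tree_covariance R n D.+1))%E.
Proof.
move=> /andP[D_ge3 D_le_n]; have D_gt0 : (0 < D)%N by lia.
set s := D.-1./2; set m := (n %/ D)%N.
(* An alternative is a full block with one of its [s] short leaves and one of its first [s] long
   leaves, which exist since [s + s < D]. *)
pose I : finType := ('I_m * ('I_s * 'I_s))%type.
have sD : (s + s < D)%N by rewrite /s; lia.
have node_lt (g : 'I_m) r : (r < D)%N -> (g * D + r < n)%N.
  move=> rD; apply: (@leq_trans (g.+1 * D)); first by rewrite mulSn addnC ltn_add2r.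
  by rewrite (leq_trans _ (leq_divM n D)) // leq_mul2r (ltn_ord g) orbT.
have rx (x : 'I_s) : (x.+1 < D)%N by have := ltn_ord x; lia.
have ry (y : 'I_s) : (s + y.+1 < D)%N by have := ltn_ord y; lia.
pose a (t : I) : 'I_n := Ordinal (node_lt t.1 _ (rx t.2.1)).
pose b (t : I) : 'I_n := Ordinal (node_lt t.1 _ (ry t.2.2)).
have node_div g r : (r < D)%N -> ((g * D + r) %/ D = g)%N.
  by move=> rD; rewrite divnMDl // divn_small ?addn0.
have node_mod g r : (r < D)%N -> ((g * D + r) %% D = r)%N.
  by move=> rD; rewrite modnMDl modn_small.
have leg_a t : leg D (a t) = 1%N by rewrite /leg node_mod //= ltn_ord.
have leg_b t : leg D (b t) = 2%N.
  by rewrite /leg node_mod // -/s addnS /= ltnNge leq_addr.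
have mov t : movable D (Some (a t, b t)).
  by move=> _ _ [<- <-]; split=> //; rewrite !node_div.
have no_mov : @movable n D None by [].
have ab_inj : injective (fun t => (a t, b t)).
  move=> t t' [ea eb].
  have e1 : t.1 = t'.1 :> nat by have := congr1 (divn^~ D) ea; rewrite !node_div.
  have e2 : t.2.1 = t'.2.1 :> nat by have := congr1 (modn^~ D) ea; rewrite !node_mod // => -[].
  have e3 : t.2.2 = t'.2.2 :> nat.
    by have := congr1 (modn^~ D) eb; rewrite !node_mod // => /addnI[].
  case: t t' {ea eb} e1 e2 e3 => [? [? ?]] [? [? ?]] /=.
  by move=> /val_inj -> /val_inj -> /val_inj ->.
have cardI : #|I| = (m * (s * s))%N by rewrite !card_prod !card_ord.
rewrite -[X in (2 * k)%:R / X%:R]cardI.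
apply: (@minimax_risk_ge _ _ _ _ _ _ (metric_cov (cater_metric D_gt0 no_mov))
  (fun t => metric_cov (cater_metric D_gt0 (mov t)))).
- by rewrite cardI !muln_gt0 divn_gt0 // D_le_n /s andbb half_gt0; lia.
- exact/metric_cov_tree/cater_degree.
- by move=> t; exact/metric_cov_tree/cater_degree.
(* The edge from [a t] to [b t] is absent from the base tree, where parents are hubs and have leg
   0. *)
- move=> t; rewrite !concentration_graph_metric => /setP/(_ (a t, b t)).
  rewrite -![_ \in parent_graph _]/(adj _ (a t) (b t)) !adj_parent_graph /=.
  have -> : (0 < cater_rank D (b t))%N.
    by rewrite addn_gt0 muln_gt0 leg_b (leq_ltn_trans (leq0n _) (ltn_ord (b t))).
  rewrite !eqxx orbT => /esym/orP[] /andP[_ /eqP e].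
    by have := leg_hub_of D (a t); rewrite e leg_b.
  by have := leg_hub_of D (b t); rewrite e leg_a.
- move=> u v.
  (* Entry [(u, v)] depends on [t] only through whether the moved pair is [(u, v)] or [(v, u)]. *)
  apply: (@card_le_codom _ _ _ _ [:: (u, v); (v, u)] ab_inj) => t.
  rewrite !inE; apply: contra_neqT; rewrite negb_or => /andP[tu tv].
  by rewrite !mxE /= /cater_dist !(inj_eq (@Some_inj _)) (negPf tu) (negPf tv).
Qed.

(** * Asymptotics and the choice of family *)

Theorem theorem16 (R : realType) (d k : nat -> nat)
  (hd : forall n : nat, (3 <= n)%N -> (2 <= d n <= n.-1)%N)
  (hk : (fun n : nat => (k n)%:R : R) =o_\oo (fun n : nat => (n * d n)%:R : R)) :
  exists2 eps : nat -> R, eps =o_\oo (fun _ : nat => 1 : R) &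
    \forall n \near \oo,
      ((1 / 2 * (1 - eps n))%:E <=
         minimax_risk (@query_bounded R n (k n)) (@tree_covariance R n (d n)))%E.
Proof.
have nd_gt0 n : (3 <= n)%N -> 0 < (n * d n)%:R :> R.
  by move=> n3; have := hd n n3; rewrite ltr0n muln_gt0; lia.
exists (fun n => 144 * (k n)%:R / (n * d n)%:R).
  apply/eqoP => e e_gt0.
  have /eqoP/(_ (e / 144)) := hk; rewrite divr_gt0 // => /(_ isT) hk'.
  near=> n.
  have n3 : (3 <= n)%N by near: n; exact: nbhs_infty_ge.
  have : `|(k n)%:R| <= e / 144 * `|(n * d n)%:R| :> R by near: n.
  rewrite !ger0_norm ?normr1 ?mulr1 ?divr_ge0 ?mulr_ge0 // ler_pdivrMr ?nd_gt0 // => h.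
  lra.
near=> n.
have n3 : (3 <= n)%N by near: n; exact: nbhs_infty_ge.
have /andP[d2 dn] := hd n n3.
(* N is the number of alternatives; 72 suits both constructions, and
   144 = 2 * 72 because a query tells at most two alternatives apart. *)
have risk_le N : (n * d n <= 72 * N)%N ->
    1 / 2 * (1 - 144 * (k n)%:R / (n * d n)%:R) <= 1 / 2 * (1 - (2 * k n)%:R / N%:R) :> R.
  move=> ndN; have ndN' : (n * d n)%:R <= 72 * N%:R :> R by rewrite -natrM ler_nat.
  have nd0 := nd_gt0 n n3.
  have N_gt0 : 0 < N%:R :> R by lra.
  rewrite ler_pM2l ?divr_gt0 // lerD2l lerN2 ler_pdivrMr // mulrAC ler_pdivlMr // natrM.
  have := ler_wpM2l (ler0n R (k n)) ndN'; lra.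
have [d4|d3] := leqP 4 (d n).
- have D_bounds : (3 <= (d n).-1 <= n)%N by lia.
  have := caterpillar_minimax_risk_ge R (k n) D_bounds; rewrite prednK; last by lia.
  apply: le_trans; rewrite lee_fin; apply: risk_le.
  (* With [m] blocks and [s] leaves of each kind, [n <= 2 m d] and [d <= 6 s] give
     [n d <= 2 m (6 s)^2 = 72 m s^2]. *)
  have lt_n : (n < (n %/ (d n).-1).+1 * (d n).-1)%N by apply: ltn_ceil; lia.
  have m_gt0 : (0 < n %/ (d n).-1)%N by rewrite divn_gt0; lia.
  have d_le : (d n <= 6 * (d n).-1.-1./2)%N by lia.
  move: (n %/ _)%N (_./2) lt_n m_gt0 d_le => m s lt_n m_gt0 d_le.
  have n_le : (n <= 2 * m * d n)%N by nia.
  apply: (leq_trans (leq_mul n_le (leqnn _))).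
  rewrite -mulnA (_ : 72 * (m * (s * s)) = 2 * m * ((6 * s) * (6 * s)))%N; last by nia.
  by rewrite leq_mul2l leq_mul ?orbT.
(* Here [n d <= 3 n], while [(n - 1) %/ 2] is at least [n / 4] for [n >= 3]. *)
- apply: le_trans (path_minimax_risk_ge _ _ n3 d2).
  by rewrite lee_fin; apply: risk_le; nia.
Unshelve. all: by end_near.
Qed.
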